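(* Let $m\ge 3$ and let $l_1\le\cdots\le l_m$ be natural numbers with $l_1\ge 2$ and $l_2\ge 4$. Then $[\Theta(l_1,\ldots,l_m)]^2$ is equitably $k$-choosable for every $k\ge m+3$.
   Context: All graphs are finite and simple. $\Theta(l_1,\ldots,l_m)$ denotes the graph consisting of two vertices $u,w$ joined by $m$ internally disjoint paths of lengths $l_1,\ldots,l_m$; the $i$th path is $u, v_{i,1},\ldots,v_{i,l_i-1}, w$. For a graph $H$, $H^2$ has vertex set $V(H)$ with two vertices adjacent iff their distance in $H$ is 1 or 2. A $k$-assignment $L$ assigns to each vertex a set of exactly $k$ colors; an equitable $L$-coloring of $G$ is a proper coloring $f$ with $f(v)\in L(v)$ such that no color is used more than $\lceil |V(G)|/k\rceil$ times; $G$ is equitably $k$-choosable if it has an equitable $L$-coloring for every $k$-assignment $L$. *)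

(* Defs.v *)
From mathcomp Require Import all_boot.
Set Implicit Arguments. Unset Strict Implicit. Unset Printing Implicit Defensive.

(* Theta(l_1,...,l_m) for l = [:: l_1; ...; l_m] (m = size l, index i is 0-based).
   Internal vertex v_{i+1, j+1} (j < l_{i+1} - 1) is the pair (i, j) below;
   sumn l is just a uniform upper bound on the second component. *)
Definition theta_int (l : seq nat) : finType :=
  {p : 'I_(size l) * 'I_(sumn l) | (p.2 < (nth 0 l p.1).-1)%N}.

(* inl true = u, inl false = w *)
Definition theta_vert (l : seq nat) : finType := (bool + theta_int l)%type.

(* adjacency between an end vertex (b = true: u, b = false: w) and an internal vertex *)
Definition theta_end_adj (l : seq nat) (b : bool) (x : theta_int l) : bool :=
  let i := (val x).1 in let j := (val x).2 in
  if b then (j == 0 :> nat) else (j == (nth 0 l i).-2 :> nat).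

Definition theta_adj (l : seq nat) : rel (theta_vert l) :=
  fun x y =>
    match x, y with
    | inl b1, inl b2 => (b1 != b2) && has (fun li => li == 1) l
    | inl b, inr z => theta_end_adj b z
    | inr z, inl b => theta_end_adj b z
    | inr z1, inr z2 =>
        ((val z1).1 == (val z2).1) &&
        (((val z1).2.+1 == (val z2).2 :> nat) || ((val z2).2.+1 == (val z1).2 :> nat))
    end.

Definition sq_graph (T : finType) (H : rel T) : rel T :=
  fun x y => (x != y) && (H x y || [exists z, H x z && H z y]).

Definition k_assignment (T : finType) (L : T -> seq nat) (k : nat) : Prop :=
  forall v, uniq (L v) /\ size (L v) = k.

Definition ceil_div (n k : nat) : nat := (n %/ k + (n %% k != 0))%N.

Definition equitable_L_coloring (T : finType) (G : rel T) (L : T -> seq nat)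
    (k : nat) (f : T -> nat) : Prop :=
  [/\ forall v, f v \in L v,
      forall x y, G x y -> f x != f y
    & forall c, (#|[set v | f v == c]| <= ceil_div #|T| k)%N].

Definition equitably_choosable (T : finType) (G : rel T) (k : nat) : Prop :=
  forall L : T -> seq nat, k_assignment L k ->
    exists f : T -> nat, equitable_L_coloring G L k f.

(* Main.v *)
Require Import Defs.
From mathcomp Require Import all_boot.
From mathcomp Require Import zify.
Set Implicit Arguments. Unset Strict Implicit. Unset Printing Implicit Defensive.

(** The vertices are colored in blocks of k, each block receiving pairwise distinct colors, so that
    every color is used at most once per block. A block can be colored greedily after the set A if it
    has an ordering in which the vertex with j successors has at most j neighbors in A. The block
    colored last consists of u, all v_{i,1}, v_{2,2}, v_{2,3} and arbitrary vertices other than w. What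
    remains is a squared spider centered at w; the block colored before consists of w, the neighbors
    of w that are ends of paths (except on the first path) and vertices taken path by path from the
    w-side. The rest induces squares of disjoint paths, which lose k consecutive vertices at a time:
    these have 2, 1, 0, 0, ... neighbors in the remainder. *)

(** * Greedy list coloring by blocks of distinct colors *)

Section EquitableBlocks.
Variables (T : finType) (G : rel T) (L : T -> seq nat) (k : nat).

Definition colorable (A : {set T}) (q : nat) : Prop :=
  exists f : T -> nat,
    [/\ {in A, forall v, f v \in L v},
        {in A &, forall x y, G x y -> f x != f y}
      & forall c, #|[set v in A | f v == c]| <= q].

Definition deg_in (A : {set T}) (x : T) : nat := #|[set y in A | G x y]|.

(* [s] is listed in the order in which it receives pairwise distinct colors, after A and as a block of
   size k: when [x] comes up, k - 1 - size s' vertices of the block are colored, and [d x] more colors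
   are forbidden by A. *)
Fixpoint fits (d : T -> nat) (s : seq T) : bool :=
  if s is x :: s' then (d x <= size s') && fits d s' else true.

Lemma fits_cat d s1 s2 :
  {in s1, forall x, d x <= size s2} -> fits d s2 -> fits d (s1 ++ s2).
Proof.
elim: s1 => [|x s1 IHs] //= ds fs2; rewrite IHs //; last first.
  by move=> y ys; apply: ds; rewrite inE ys orbT.
by rewrite andbT size_cat (leq_trans (ds x _)) ?mem_head ?leq_addl.
Qed.

(** Neighbors are counted through their labels. The list [s] may repeat labels or contain some that
    no vertex carries, so truncated coordinates near the end of a path do no harm in later
    applications. *)
Lemma deg_in_le (K : eqType) (g : T -> K) (A : {set T}) x (s : seq K) :
  {in A &, injective g} -> {in A, forall y, G x y -> g y \in s} ->
  deg_in A x <= size s.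
Proof.
move=> g_inj sub_s; rewrite /deg_in cardE -(size_map g).
apply: uniq_leq_size.
  rewrite map_inj_in_uniq ?enum_uniq // => y z.
  by rewrite !mem_enum !inE => /andP[yA _] /andP[zA _]; apply: g_inj.
by move=> _ /mapP[y + ->]; rewrite mem_enum inE => /andP[/sub_s].
Qed.

Lemma colorable_sub0 : colorable set0 0.
Proof.
exists (fun=> 0); split=> [v|v w|c]; rewrite ?inE //.
by rewrite leqn0 cards_eq0; apply/eqP/setP=> v; rewrite !inE.
Qed.

Hypotheses (symG : symmetric G) (irrG : irreflexive G).
Hypothesis (kL : k_assignment L k).

Lemma pick_color v (t : seq nat) : size t < k -> exists2 c, c \in L v & c \notin t.
Proof.
have [uL sL] := kL v; rewrite -sL => lt_t.
have /allPn[c cL ct] : ~~ all (mem t) (L v).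
  by apply/negP=> /allP /(uniq_leq_size uL); rewrite leqNgt lt_t.
by exists c.
Qed.

(** Invariant of the greedy coloring, with [r] the part of the block already colored. When [x] comes
    up before [s'], the part [r] forbids at most [size r] colors and the neighbors in [A] at most
    [size s']; together this is less than [k]. *)
Lemma extend_coloring (A : {set T}) s r (f : T -> nat) :
  uniq (r ++ s) -> {in r ++ s, forall x, x \notin A} -> size r + size s <= k ->
  fits (deg_in A) s ->
  {in A :|: [set x in r], forall v, f v \in L v} ->
  {in A :|: [set x in r] &, forall x y, G x y -> f x != f y} ->
  uniq (map f r) ->
  exists g, [/\ {in A, g =1 f},
    {in A :|: [set x in r ++ s], forall v, g v \in L v},
    {in A :|: [set x in r ++ s] &, forall x y, G x y -> g x != g y} &
    uniq (map g (r ++ s))].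
Proof.
elim: s r f => [|x s IHs] r f; first by rewrite cats0 => *; exists f.
rewrite -cat_rcons => urs rsA szk /= /andP[dx fs] fL fG uf.
pose nbr := enum [set y in A | G x y].
have [|c cL] := @pick_color x (map f r ++ map f nbr).
  rewrite size_cat !size_map -cardE; move: szk dx; rewrite /deg_in /=; lia.
rewrite mem_cat negb_or => /andP[cr cA].
have xr : x \notin r by move: urs; rewrite cat_uniq rcons_uniq => /andP[/andP[]].
have xA : x \notin A by apply: rsA; rewrite mem_cat mem_rcons mem_head.
pose g v := if v == x then c else f v.
have gf v : v != x -> g v = f v by rewrite /g => /negPf->.
have gx : g x = c by rewrite /g eqxx.
have gr : map g r = map f r.
  by apply/eq_in_map=> v vr; rewrite gf //; apply: contraNneq xr => <-.
have cG y : y \in A :|: [set z in r] -> G x y -> c != f y.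
  rewrite !inE => /orP[yA Gxy|yr _].
    apply: contraNneq cA => ->; apply: map_f.
    by rewrite mem_enum inE yA.
  by apply: contraNneq cr => ->; apply: map_f.
have split_x v : v \in A :|: [set z in rcons r x] ->
    v = x \/ (v != x /\ v \in A :|: [set z in r]).
  rewrite !inE mem_rcons inE; case: (eqVneq v x) => [->|vx]; first by left.
  by right.
have [||||||h [hA hL hG uh]] := IHs (rcons r x) g _ rsA => //.
- by rewrite size_rcons addSnnS.
- by move=> v /split_x[->|[vx vA]]; rewrite ?gx // gf // fL.
- move=> v w /split_x[->|[vx vA]] /split_x[->|[wx wA]]; rewrite ?irrG //.
  + by rewrite gx (gf w) //; apply: cG.
  + by rewrite gx (gf v) // symG eq_sym; apply: cG.
  + by rewrite !gf //; apply: fG.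
- by rewrite map_rcons gx gr rcons_uniq cr.
exists h; split=> // v vA; rewrite hA // gf //.
by apply: contraNneq xA => <-.
Qed.

(** The colors on [s] are pairwise distinct, so each color class grows by at most one. *)
Lemma colorable_block (A : {set T}) q s :
  uniq s -> {in s, forall x, x \notin A} -> size s <= k ->
  fits (deg_in A) s -> colorable A q -> colorable (A :|: [set x in s]) q.+1.
Proof.
move=> us sA sk fs [f [fL fG fq]].
have A0 : A :|: [set x in Nil T] = A by apply/setP=> v; rewrite !inE orbF.
have [|||g [gA gL gG ug]] := @extend_coloring A s [::] f us sA sk fs; rewrite ?A0 //.
exists g; split=> // c.
have -> : [set v in A :|: [set x in s] | g v == c] =
    [set v in A | f v == c] :|: [set v in s | g v == c].
  apply/setP=> v; rewrite !inE; case: (boolP (v \in A)) => //= vA.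
  by rewrite gA //; case: eqP => //=; rewrite ?andbF ?orbF.
apply: leq_trans (leq_card_setU _ _) _; rewrite -addn1 leq_add //.
have -> : [set v in s | g v == c] = [set v in filter (preim g (pred1 c)) s].
  by apply/setP=> v; rewrite !inE mem_filter andbC.
rewrite cardsE (card_uniqP _) ?filter_uniq // size_filter -count_map.
by rewrite count_uniq_mem // leq_b1.
Qed.

Lemma colorable_small (A : {set T}) : #|A| <= k -> colorable A 1.
Proof.
move=> Ak; rewrite -[A]set0U -[A in _ :|: A]set_enum.
apply: colorable_block colorable_sub0; rewrite ?enum_uniq -?cardE //.
  by move=> x _; rewrite inE.
have dz : deg_in set0 =1 (fun=> 0).
  by move=> x; rewrite /deg_in; apply/eqP; rewrite cards_eq0; apply/eqP/setP=> y; rewrite !inE.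
by elim: (enum A) => //= x s ->; rewrite dz.
Qed.

(** * Blocks of consecutive vertices in squares of disjoint paths *)

Section Keyed.
Variables (A : {set T}) (key : T -> nat).
Hypothesis (key_inj : {in A &, injective key}).
Hypothesis (key_G : {in A &, forall x y, G x y -> key x <= key y + 2}).

(** Here [p] counts the block vertices already passed. The neighbors in [B] of the head of [s] have
    keys from t + p - 2 to t - 1, hence number at most 2 - p: the bounds are 2, 1, 0, 0, ... along
    the block, and three vertices suffice to meet them. *)
Lemma fits_top (B : {set T}) t p s :
  B \subset A -> {subset s <= A} -> {in B, forall y, key y < t} ->
  {in s, forall x, t + p <= key x} -> sorted ltn (map key s) ->
  3 <= p + size s -> fits (deg_in B) s.
Proof.
move=> BA; elim: s p => [|x s IHs] p //= sA Bt st ss szs.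
apply/andP; split.
  apply: leq_trans (_ : size (iota (t + p - 2) (2 - p)) <= _); last first.
    by rewrite size_iota; move: szs => /=; lia.
  apply: (@deg_in_le _ key) => [y z yB zB|y yB Gxy].
    by apply: key_inj; apply: (subsetP BA).
  have yA := subsetP BA _ yB; have xA := sA x (mem_head _ _).
  have := key_G xA yA Gxy; have := Bt y yB; have := st x (mem_head _ _).
  rewrite mem_iota; lia.
apply: (IHs p.+1) => //.
- by move=> y ys; apply: sA; rewrite inE ys orbT.
- move=> y ys; have := st x (mem_head _ _).
  move: ss; rewrite (path_sortedE ltn_trans) => /andP[/allP/(_ (key y)) + _].
  rewrite map_f // => /(_ isT); lia.
- exact: path_sorted ss.
- by rewrite addSnnS.
Qed.

Lemma top_block r : 3 <= r -> r <= #|A| ->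
  exists s, [/\ uniq s, size s = r, {subset s <= A}
    & fits (deg_in (A :\: [set x in s])) s].
Proof.
move=> r3 rA; pose z := sort (relpre key leq) (enum A).
have zA : z =i A by move=> x; rewrite mem_sort mem_enum.
have uz : uniq z by rewrite sort_uniq enum_uniq.
have sz : size z = #|A| by rewrite size_sort cardE.
have kz : sorted ltn (map key z).
  rewrite ltn_sorted_uniq_leq map_inj_in_uniq ?uz; last first.
    by move=> x y; rewrite !zA; apply: key_inj.
  by rewrite -sort_map sort_sorted //; apply: leq_total.
have zE := cat_take_drop (#|A| - r) z.
set z1 := take _ z in zE; set s := drop _ z in zE.
have sA : {subset s <= A} by move=> x xs; rewrite -zA -zE mem_cat xs orbT.
have ss : size s = r by rewrite size_drop sz subKn.
have us : uniq s by rewrite drop_uniq.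
exists s; split=> //.
move: kz; rewrite -zE map_cat (sorted_pairwise ltn_trans) pairwise_cat.
rewrite -!(sorted_pairwise ltn_trans) => /and3P[/allrelP z1s _ sorted_s].
case Es: s ss => [|a s'] ss; first by rewrite -ss in r3.
(* The least key in the block is the threshold separating it from the rest of [A]. *)
rewrite -Es; apply: (@fits_top _ (key a) 0) => //.
- exact: subsetDl.
- move=> y; rewrite !inE => /andP[ys yA]; apply: z1s.
    by move: yA ys; rewrite -zA -zE mem_cat => /orP[yz1 _|->//]; apply: map_f.
  by rewrite Es map_f // mem_head.
- move=> x; rewrite Es inE addn0 => /orP[/eqP->//|xs'].
  move: sorted_s; rewrite Es /= (path_sortedE ltn_trans) => /andP[/allP/(_ (key x)) + _].
  by rewrite map_f // => /(_ isT) /ltnW.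
- by rewrite Es ss.
Qed.

End Keyed.

Lemma ceil_divDr n : 0 < k -> ceil_div (n + k) k = (ceil_div n k).+1.
Proof. by move=> k0; rewrite /ceil_div divnDr // divnn k0 modnDr addn1. Qed.

Lemma ceil_div_gt0 n : 0 < k -> 0 < n -> 0 < ceil_div n k.
Proof.
move=> k0; rewrite /ceil_div {1}(divn_eq n k).
by case: (n %/ k) => //; case: (n %% k).
Qed.

Lemma leq_colorable (A : {set T}) q q' : q <= q' -> colorable A q -> colorable A q'.
Proof. by move=> qq [f [fL fG fq]]; exists f; split=> // c; apply: leq_trans (fq c) qq. Qed.

Lemma colorable_le (A : {set T}) : 0 < k -> #|A| <= k -> colorable A (ceil_div #|A| k).
Proof.
move=> k0 Ak; have [/cards0_eq->|A0] := posnP #|A|.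
  exact: leq_colorable colorable_sub0.
exact: leq_colorable (ceil_div_gt0 k0 A0) (colorable_small Ak).
Qed.

(** Removing exactly [k] vertices lowers the ceiling by one, which pays for the one additional use
    of each color. *)
Lemma colorable_full_block (A : {set T}) s : 0 < k ->
  uniq s -> size s = k -> {subset s <= A} -> fits (deg_in (A :\: [set x in s])) s ->
  colorable (A :\: [set x in s]) (ceil_div #|A :\: [set x in s]| k) ->
  colorable A (ceil_div #|A| k).
Proof.
move=> k0 us sk sA fs cB.
have sAs : [set x in s] \subset A by apply/subsetP=> x; rewrite inE; apply: sA.
have cs : #|[set x in s]| = k by rewrite cardsE (card_uniqP us).
have -> : #|A| = #|A :\: [set x in s]| + k.
  by rewrite cardsDS // cs subnK // -cs subset_leq_card.
have {1}-> : A = (A :\: [set x in s]) :|: [set x in s].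
  by rewrite setUC -{1}(setIidPr sAs) setID.
rewrite ceil_divDr //; apply: colorable_block; rewrite ?sk //.
by move=> x xs; rewrite !inE xs.
Qed.

(** Induction on the size of [A]: the [k] vertices of largest key form a block, and both hypotheses
    on the key pass to the remainder. *)
Lemma colorable_keyed (A : {set T}) (key : T -> nat) : 3 <= k ->
  {in A &, injective key} -> {in A &, forall x y, G x y -> key x <= key y + 2} ->
  colorable A (ceil_div #|A| k).
Proof.
move=> k3; have k0 : 0 < k by lia.
have [n] := ubnP #|A|; elim: n A => // n IHn A An kI kG.
have [|kA] := leqP #|A| k; first exact: colorable_le.
have [s [us sk sA fs]] := top_block kI kG k3 (ltnW kA).
apply: (colorable_full_block k0 us sk sA fs); apply: IHn.
- have : #|A :\: [set x in s]| < #|A|; last by move: An; lia.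
  rewrite cardsDS; last by apply/subsetP=> x; rewrite inE; apply: sA.
  rewrite cardsE (card_uniqP us) sk; lia.
- by move=> x y /setDP[xA _] /setDP[yA _]; apply: kI.
- by move=> x y /setDP[xA _] /setDP[yA _]; apply: kG.
Qed.

End EquitableBlocks.

(** * Coordinates and adjacency in the squared theta graph *)

Section ThetaSquare.
Variable l : seq nat.
Local Notation m := (size l).
Local Notation len := (nth 0 l).
Local Notation T := (theta_vert l).

(* Internal vertices keep their 0-based coordinates; the ends u and w are placed on a fictitious path m. *)
Definition pos (x : T) : nat * nat :=
  match x with
  | inl b => (m, nat_of_bool (~~ b))
  | inr z => (nat_of_ord (val z).1, nat_of_ord (val z).2)
  end.

Lemma pos_inj : injective pos.
Proof.
case=> [b|[[i j] ij]] [c|[[i' j'] ij']] //= [].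
- by case: b; case: c.
- by move=> e; have := ltn_ord i'; rewrite -e ltnn.
- by move=> e; have := ltn_ord i; rewrite e ltnn.
- by move=> /ord_inj e /ord_inj e'; congr inr; apply: val_inj; rewrite /= e e'.
Qed.

Variant pos_spec (x : T) : nat * nat -> Prop :=
  | PosU : pos_spec x (m, 0)
  | PosW : pos_spec x (m, 1)
  | PosInt a b of a < m & b.+1 < len a : pos_spec x (a, b).

Lemma posP x : pos_spec x (pos x).
Proof.
case: x => [[]|[[i j] /= ij]]; [exact: PosU|exact: PosW|].
by apply: PosInt; rewrite ?ltn_ord //; move: ij; rewrite /=; case: (len i) => [|[|]].
Qed.

Lemma nth_le_sumn i : len i <= sumn l.
Proof.
elim: l i => [|a s IHs] [|i] //=; first exact: leq_addr.
exact: leq_trans (IHs i) (leq_addl _ _).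
Qed.

(** Inverse of [pos]; w is only a default for coordinates that no vertex has. *)
Definition vertex (i j : nat) : T := odflt (inl false) [pick x | pos x == (i, j)].

Lemma pos_vertex i j : i < m -> j.+1 < len i -> pos (vertex i j) = (i, j).
Proof.
move=> im jl; rewrite /vertex; case: pickP => [x /eqP//|].
have js : j < sumn l by have := nth_le_sumn i; lia.
have ok : (Ordinal im, Ordinal js).2 < (nth 0 l (Ordinal im, Ordinal js).1).-1.
  by move: jl; rewrite /=; case: (len i).
by move/(_ (inr (exist _ (Ordinal im, Ordinal js) ok))); rewrite /= eqxx.
Qed.

(* Adjacency in the square, read on coordinates and simplified under the hypotheses l_1 >= 2, l_2 >= 4;
   only the inclusion [sq_theta_near] is needed. *)
Definition near_end (b : nat) (q : nat * nat) : bool :=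
  (b == 0) && (q.2 <= 1) || (b == 1) && (len q.1 <= q.2 + 3).

Definition close (p q : nat * nat) : bool :=
  [|| [&& p.1 == m, q.1 == m & len 0 == 2],
      [&& p.1 == m, q.1 < m & near_end p.2 q],
      [&& q.1 == m, p.1 < m & near_end q.2 p]
    | [&& p.1 < m, q.1 < m &
        [|| [&& p.1 == q.1, p.2 <= q.2 + 2 & q.2 <= p.2 + 2],
            (p.2 == 0) && (q.2 == 0)
          | (p.2.+2 == len p.1) && (q.2.+2 == len q.1)]]].

Definition near (x y : T) : bool := (pos x != pos y) && close (pos x) (pos y).

Lemma close_sym : symmetric close.
Proof.
move=> p q; rewrite /close andbCA; congr (_ || _); rewrite orbCA; congr (_ || (_ || _)).
rewrite andbCA; congr (_ && (_ && _)).
by rewrite (eq_sym q.1) [(_ <= _) && _ in RHS]andbC [(_ == 0) && _ in RHS]andbC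
  [(_ == len _) && _ in RHS]andbC.
Qed.

Lemma near_sym : symmetric near.
Proof. by move=> x y; rewrite /near eq_sym close_sym. Qed.

Lemma near_irr : irreflexive near.
Proof. by move=> x; rewrite /near eqxx. Qed.

Lemma close_ends b b' : len 0 = 2 -> close (m, b) (m, b').
Proof. by move=> l2; rewrite /close /= l2 !eqxx. Qed.

Lemma close_u i j : i < m -> j <= 1 -> close (m, 0) (i, j).
Proof. by move=> im j1; rewrite /close /near_end /= !eqxx im j1 orbT. Qed.

Lemma close_w i j : i < m -> len i <= j + 3 -> close (m, 1) (i, j).
Proof. by move=> im lj; rewrite /close /near_end /= !eqxx im lj !orbT. Qed.

Lemma close_path i j j' : i < m -> j <= j' + 2 -> j' <= j + 2 -> close (i, j) (i, j').
Proof. by move=> im h h'; rewrite /close /= eqxx im h h' !orbT. Qed.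

Lemma close_first i i' : i < m -> i' < m -> close (i, 0) (i', 0).
Proof. by move=> im im'; rewrite /close /= im im' !orbT. Qed.

Lemma close_last i j i' j' : i < m -> i' < m -> j.+2 = len i -> j'.+2 = len i' ->
  close (i, j) (i', j').
Proof. by move=> im im' h h'; rewrite /close /= im im' h h' !eqxx !orbT. Qed.

Variant close_spec a b c d : Prop :=
  | ClosePath of a = c & b <= d + 2 & d <= b + 2
  | CloseFirst of b = 0 & d = 0
  | CloseLast of b.+2 = len a & d.+2 = len c.

Lemma closeP a b c d : a < m -> c < m -> close (a, b) (c, d) -> close_spec a b c d.
Proof.
move=> am cm; rewrite /close /= (ltn_eqF am) (ltn_eqF cm) am cm /=.
by case/or3P=> [/and3P[/eqP]|/andP[/eqP ? /eqP]|/andP[/eqP ? /eqP]];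
  [apply: ClosePath|apply: CloseFirst|apply: CloseLast].
Qed.

Lemma close_uP c d : c < m -> close (m, 0) (c, d) -> d <= 1.
Proof.
by move=> cm; rewrite /close /near_end /= (ltn_eqF cm) cm ltnn eqxx /= !orbF.
Qed.

Lemma close_wP c d : c < m -> close (m, 1) (c, d) -> len c <= d + 3.
Proof.
by move=> cm; rewrite /close /near_end /= (ltn_eqF cm) cm ltnn eqxx /= !orbF.
Qed.

Hypotheses (m3 : 3 <= m) (len0 : 2 <= len 0).
Hypothesis (lenS : forall i, 0 < i -> i < m -> 4 <= len i).

Lemma len_ge2 i : i < m -> 2 <= len i.
Proof. by case: i => // i im; have := lenS (ltn0Sn i) im; lia. Qed.

Lemma len_eq2 i : i < m -> len i = 2 -> len 0 = 2.
Proof. by case: (posnP i) => [->//|i0 im]; have := lenS i0 im; lia. Qed.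

(** Edges of the theta graph itself, given as an inductive family so that walks of length two are
    enumerated by inversion. *)
Variant step : nat * nat -> nat * nat -> Prop :=
  | StepU i of i < m : step (m, 0) (i, 0)
  | StepW i j of i < m & j.+2 = len i : step (m, 1) (i, j)
  | StepUV i of i < m : step (i, 0) (m, 0)
  | StepWV i j of i < m & j.+2 = len i : step (i, j) (m, 1)
  | StepIncr i j of i < m & j.+2 < len i : step (i, j) (i, j.+1)
  | StepDecr i j of i < m & j.+2 < len i : step (i, j.+1) (i, j).

Lemma theta_adj_step x y : theta_adj x y -> step (pos x) (pos y).
Proof.
case: x y => [b|[[i j] /= ij]] [c|[[i' j'] /= ij']] /=.
(* An edge between u and w would require a path of length 1. *)
- case/andP=> _ /hasP[a /(nthP 0)[i im <-] /eqP e].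
  by have := len_ge2 im; rewrite e.
- rewrite /theta_end_adj /=; case: b => /= /eqP e.
    by rewrite e; apply: StepU.
  by apply: StepW; rewrite // e; case: (len i') ij' => [|[|]].
- rewrite /theta_end_adj /=; case: c => /= /eqP e.
    by rewrite e; apply: StepUV.
  by apply: StepWV; rewrite // e; case: (len i) ij => [|[|]].
- case/andP=> /eqP e; case: i' / e ij' => ij' /orP[] /eqP e.
    by rewrite -e; apply: StepIncr; rewrite // e; lia.
  by rewrite -e; apply: StepDecr; rewrite // e; lia.
Qed.

Lemma step_close p q : step p q -> close p q.
Proof.
case=> [i im|i j im e|i im|i j im e|i j im e|i j im e].
- exact: close_u.
- by apply: close_w; rewrite // -e !addnS addn0.
- by rewrite close_sym; apply: close_u.
- by rewrite close_sym; apply: close_w; rewrite // -e !addnS addn0.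
- by apply: close_path => //; clear; lia.
- by apply: close_path => //; clear; lia.
Qed.

(** By the middle vertex: u joins first vertices and w joins last ones. An internal vertex joins
    vertices two apart on its path, an end to the second vertex from it, or u to w on a path of
    length 2. *)
Lemma step2_close p r q : step p r -> step r q -> p = q \/ close p q.
Proof.
case=> [i im|i j im e|i im|i j im e|i j im e|i j im e] H; inversion H; subst;
  try (by left); right;
  try match goal with H : is_true (m < m) |- _ => by rewrite ltnn in H end.
all: first
  [ by apply: close_first | by apply: close_last
  | apply: close_path; lia
  | apply: close_u; lia | apply: close_w; lia
  | rewrite close_sym; apply: close_u; lia | rewrite close_sym; apply: close_w; lia
  | by apply: close_ends; apply: (len_eq2 im) ].
Qed.

Lemma sq_theta_near (x y : T) : sq_graph (@theta_adj l) x y -> near x y.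
Proof.
case/andP=> xy H; rewrite /near (inj_eq pos_inj) xy /=.
case/orP: H => [/theta_adj_step/step_close //|/existsP[z /andP[/theta_adj_step xz]]].
move/theta_adj_step/(step2_close xz)=> [/pos_inj e|//].
by rewrite e eqxx in xy.
Qed.

(** * The core of the block colored last *)

Definition base_pos : seq (nat * nat) :=
  [:: (1, 2); (0, 0); (m, 0)] ++ [seq (i, 0) | i <- iota 2 (m - 2)]
    ++ [:: (1, 1); (1, 0)].

(* Contains the closed neighborhood of its last element v_{2,1}, so that d = 0 there. *)
Definition base : seq T :=
  [:: vertex 1 2; vertex 0 0; inl true] ++ [seq vertex i 0 | i <- iota 2 (m - 2)]
    ++ [:: vertex 1 1; vertex 1 0].

Lemma pos_base_vertices : [/\ pos (vertex 1 2) = (1, 2), pos (vertex 0 0) = (0, 0),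
  pos (vertex 1 1) = (1, 1) & pos (vertex 1 0) = (1, 0)].
Proof.
have l1 := lenS (ltn0Sn 0) (ltnW m3).
by split; apply: pos_vertex; lia.
Qed.

Lemma map_pos_base : map pos base = base_pos.
Proof.
have [p12 p00 p11 p10] := pos_base_vertices.
rewrite /base /base_pos !map_cat /= -map_comp p12 p00 p11 p10.
congr [:: _, _, _ & _ ++ _]; apply/eq_in_map => i; rewrite mem_iota => im /=.
rewrite pos_vertex //; first by lia.
by have li := @lenS i; lia.
Qed.

Lemma mem_base x : (x \in base) =
  let p := pos x in (p.1 == 1) && (p.2 <= 2) || (p.2 == 0) && (p.1 <= m).
Proof.
rewrite -(mem_map pos_inj) map_pos_base /=; case: (pos x) => a b /=.
rewrite /base_pos !(inE, mem_cat) !xpair_eqE.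
have -> : ((a, b) \in [seq (i, 0) | i <- iota 2 (m - 2)]) = (b == 0) && (2 <= a < m).
  apply/mapP/andP => [[i + [-> ->]]|[/eqP-> am]]; rewrite ?mem_iota; first by lia.
  by exists a; rewrite ?mem_iota //; lia.
by apply/idP/idP; lia.
Qed.

Lemma uniq_base : uniq base.
Proof.
rewrite -(map_inj_uniq pos_inj) map_pos_base /base_pos /= !cat_uniq /=.
rewrite !inE !mem_cat !inE !xpair_eqE map_inj_uniq ?iota_uniq; last by move=> i j [].
have H a b : (a < 2) || (m <= a) || (0 < b) ->
    ((a, b) \in [seq (i, 0) | i <- iota 2 (m - 2)]) = false.
  by move=> ab; apply/mapP=> -[i]; rewrite mem_iota => im [ea eb]; lia.
by rewrite !H /=; lia.
Qed.

Lemma size_base : size base = m + 3.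
Proof. by rewrite !size_cat size_map size_iota /=; lia. Qed.

(** * Degrees into sets that avoid this core *)

Section OutsideBase.
Variable B : {set T}.
Hypothesis (Bbase : {in B, forall y, y \notin base}).

Lemma outside_base y : y \in B -> pos y = (m, 1) \/
  exists c d, pos y = (c, d) /\ [&& c < m, d.+1 < len c, 0 < d & (c != 1) || (2 < d)].
Proof.
move=> /Bbase; rewrite mem_base; case: (posP y) => /= [||c d cm dl]; [lia|by left|].
by move=> H; right; exists c, d; split=> //; lia.
Qed.

Lemma deg_outside_le x (s : seq (nat * nat)) :
  (close (pos x) (m, 1) -> (m, 1) \in s) ->
  (forall c d, c < m -> d.+1 < len c -> 0 < d -> (c != 1) || (2 < d) ->
     pos x <> (c, d) -> close (pos x) (c, d) -> (c, d) \in s) ->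
  deg_in near B x <= size s.
Proof.
move=> sW sI; apply: (@deg_in_le _ _ _ pos) => [y z _ _|y yB /andP[/eqP]]; first exact: pos_inj.
case: (outside_base yB) => [->|[c [d [->]]]]; first by move=> _; apply: sW.
by case/and4P; apply: sI.
Qed.

(** Since u and all first vertices lie in [base], the last vertex of a path sees at most w, its two
    predecessors and the m - 1 other last vertices. Any other vertex sees at most w and four
    vertices of its path, and 5 <= m + 2. *)
Lemma deg_interior x a b : pos x = (a, b) -> a < m -> b.+1 < len a -> 0 < b ->
  deg_in near B x <= m + 2.
Proof.
move=> px am bl b0; have [be|bne] := eqVneq b.+2 (len a).
  pose s := [:: (m, 1); (a, b.-1); (a, b.-2)] ++
    [seq (i, len i - 2) | i <- rem a (iota 0 m)].
  have ss : size s = m + 2.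
    by rewrite size_cat size_map size_rem ?mem_iota // size_iota /=; lia.
  rewrite -ss; apply: deg_outside_le => [_|c d cm dl d0 _]; first by rewrite mem_head.
  rewrite px => ne /(closeP am cm)[e h _|e|_ e].
  - have /orP[] : (d == b.-1) || (d == b.-2).
      have : d != b by apply/eqP=> e'; rewrite e e' in ne.
      by rewrite -e -be in dl; clear -dl h; lia.
    + by move/eqP->; rewrite -e !inE eqxx !orbT.
    + by move/eqP->; rewrite -e !inE eqxx !orbT.
  - by rewrite e in b0.
  - have -> : d = len c - 2 by rewrite -e !subSS subn0.
    rewrite mem_cat map_f ?orbT // mem_rem_uniq ?iota_uniq // inE mem_iota add0n cm !andbT.
    by apply/eqP=> e'; apply: ne; congr pair => //; move: be; rewrite -e' -e => -[].
apply: leq_trans (_ : 5 <= _); last by rewrite addn2 !ltnS.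
apply: (@deg_outside_le _ [:: (m, 1); (a, b.-1); (a, b.-2); (a, b.+1); (a, b.+2)]).
  by rewrite mem_head.
move=> c d cm dl d0 _; rewrite px => ne /(closeP am cm)[e h h'|e _|e _].
- have : [|| d == b.-1, d == b.-2, d == b.+1 | d == b.+2].
    have : d != b by apply/eqP=> e'; rewrite e e' in ne.
    by clear -h h'; lia.
  by case/or4P=> /eqP->; rewrite -e !inE eqxx !orbT.
- by rewrite e in b0.
- by rewrite e eqxx in bne.
Qed.

(** If the first path has length 2, this vertex is also the last of its path and sees only w and the
    m - 1 other last vertices. Otherwise it sees at most w and the next two vertices of its path. *)
Lemma deg_v00 x : pos x = (0, 0) -> deg_in near B x <= m.
Proof.
have m0 : 0 < m by apply: leq_trans m3.
move=> px; have [l2|l2] := eqVneq (len 0) 2.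
  pose s := (m, 1) :: [seq (i, len i - 2) | i <- iota 1 (m - 1)].
  have ss : size s = m by rewrite /= size_map size_iota subn1 prednK.
  rewrite -[X in _ <= X]ss; apply: deg_outside_le => [_|c d cm dl d0 _].
    by rewrite mem_head.
  rewrite px => ne /(closeP m0 cm)[e _ _|_ e|_ e]; last 1 first.
  - have -> : d = len c - 2 by rewrite -e !subSS subn0.
    rewrite inE map_f ?orbT // mem_iota subnKC // cm andbT.
    by case: c cm e dl ne => [|//]; rewrite l2 => _ [->].
  - by move: dl d0; rewrite -e l2 !ltnS leqn0 => /eqP->.
  - by rewrite e in d0.
apply: leq_trans m3.
apply: (@deg_outside_le _ [:: (m, 1); (0, 1); (0, 2)]); first by rewrite mem_head.
move=> c d cm dl d0 _; rewrite px => ne /(closeP m0 cm)[<- _ d2|_ e|e].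
- by case: d d0 d2 {dl ne} => [|[|[]]] // _ _; rewrite !inE eqxx !orbT.
- by rewrite e in d0.
- by rewrite -e eqxx in l2.
Qed.

(** Besides w, only second vertices of paths can count, and that of the second path lies in
    [base]. *)
Lemma deg_u x : pos x = (m, 0) -> deg_in near B x <= m.
Proof.
have m1 : 1 < m by apply: leq_trans m3.
move=> px; pose s := (m, 1) :: [seq (i, 1) | i <- rem 1 (iota 0 m)].
have ss : size s = m.
  by rewrite /= size_map size_rem ?mem_iota // size_iota prednK // ltnW.
rewrite -[X in _ <= X]ss; apply: deg_outside_le => [_|c d cm dl d0 c1].
  by rewrite mem_head.
rewrite px => _ /(close_uP cm) d1; have e : d = 1 by apply/eqP; rewrite eqn_leq d1.
rewrite e orbF in c1.
by rewrite e inE map_f ?orbT // mem_rem_uniq ?iota_uniq // inE mem_iota c1.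
Qed.

(** A path of length at least 4 keeps w out of reach, so only the next two vertices of the path
    remain. *)
Lemma deg_first x a : pos x = (a, 0) -> 0 < a -> a < m -> deg_in near B x <= 2.
Proof.
move=> px a0 am; have la := lenS a0 am.
apply: (@deg_outside_le _ [:: (a, 1); (a, 2)]).
  by rewrite px close_sym => /(close_wP am) /(leq_trans la).
move=> c d cm dl d0 _; rewrite px => ne /(closeP am cm)[<- _ d2|_ e|e].
- by case: d d0 d2 {dl ne} => [|[|[]]] // _ _; rewrite !inE eqxx ?orbT.
- by rewrite e in d0.
- by rewrite -e in la.
Qed.

(** Both path neighbors of v_{2,2} are in [base]. Two steps further along lies w if the path has
    length 4, and v_{2,4} otherwise. *)
Lemma deg_v11 x : pos x = (1, 1) -> deg_in near B x <= 1.
Proof.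
have m1 : 1 < m by apply: leq_trans m3.
move=> px; have la := lenS (ltn0Sn 0) m1.
have [l4|l4] := eqVneq (len 1) 4.
  apply: (@deg_outside_le _ [:: (m, 1)]); first by rewrite mem_head.
  move=> c d cm dl d0 c1; rewrite px => ne /(closeP m1 cm)[e _ _|//|e].
    by move: c1 dl; rewrite -e l4 /= => d2; rewrite ltnS ltnNge d2.
  by rewrite -e in la.
apply: (@deg_outside_le _ [:: (1, 3)]).
  rewrite px close_sym => /(close_wP m1) h.
  by case/negP: l4; rewrite eqn_leq h la.
move=> c d cm dl d0 c1; rewrite px => ne /(closeP m1 cm)[e _ d3|//|e].
  by move: c1; rewrite -e /= => d2; have -> : d = 3 by apply/eqP; rewrite eqn_leq d3.
by rewrite -e in la.
Qed.

Lemma deg_v10 x : pos x = (1, 0) -> deg_in near B x <= 0.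
Proof.
have m1 : 1 < m by apply: leq_trans m3.
move=> px; have la := lenS (ltn0Sn 0) m1.
apply: (@deg_outside_le _ [::]).
  by rewrite px close_sym => /(close_wP m1) /(leq_trans la).
move=> c d cm dl d0 c1; rewrite px => ne /(closeP m1 cm)[e _ d3|_ e|e].
- by move: c1; rewrite -e /= ltnNge d3.
- by rewrite e in d0.
- by rewrite -e in la.
Qed.

(** In the order of [base] the numbers of successors are m + 2, m + 1, m, then at least 2 for each
    of the m - 2 first vertices, then 1 and 0. The degree bounds are m + 2, m, m, 2, 1 and 0. *)
Lemma fits_base : fits (deg_in near B) base.
Proof.
have la := lenS (ltn0Sn 0) (ltnW m3).
have [p12 p00 p11 p10] := pos_base_vertices.
rewrite /base /= !size_cat size_map size_iota /=.
have := deg_interior p12 (ltnW m3) la isT; have := deg_v00 p00; have := @deg_u (inl true) erefl.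
move=> du d00 d12; rewrite fits_cat ?andbT.
- by apply/and3P; split; [apply: leq_trans d12 _|apply: leq_trans d00 _|apply: leq_trans du _]; lia.
- move=> _ /mapP[i + ->]; rewrite mem_iota => im.
  have li : 4 <= len i by apply: lenS; lia.
  by apply: (@deg_first _ i); first (apply: pos_vertex); lia.
- by rewrite /= (deg_v11 p11) (deg_v10 p10).
Qed.

End OutsideBase.

(** Lexicographic order of coordinates packed into one number; every second coordinate is below
    [(sumn l).+1]. *)
Definition key (x : T) : nat := (pos x).1 * (sumn l).+1 + (pos x).2.

Lemma key_inj : injective key.
Proof.
have H x : (pos x).2 < (sumn l).+1.
  case: (posP x) => [||a b am bl] //=; last exact: ltnW (leq_trans bl (leq_trans (nth_le_sumn a) _)).
  by rewrite ltnS (leq_trans _ (nth_le_sumn 0)) // ltnW.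
move=> x y; have := (H x, H y); rewrite /key => -[].
case Ex: (pos x) => [a b]; case Ey: (pos y) => [c d] /= bM dM e.
apply: pos_inj; rewrite Ex Ey; have ac : a = c.
  by have := congr1 (divn^~ (sumn l).+1) e; rewrite !divnMDl // !divn_small ?addn0.
by move: e; rewrite ac => /addnI ->.
Qed.

(** * The squared spider without its center and path ends *)

Section InsideSpider.
Variable R : {set T}.
Hypothesis Rpos : forall y, y \in R -> exists c d, pos y = (c, d) /\
  [/\ c < m, d.+1 < len c, 0 < d & c = 0 \/ d.+2 < len c].

(** Adjacency between different paths needs two first or two last vertices. [R] has no first
    vertices, and a last one only on the first path. *)
Lemma key_near : {in R &, forall x y, near x y -> key x <= key y + 2}.
Proof.
move=> x y /Rpos[a [b [px [am bl b0 ha]]]] /Rpos[c [d [py [cm dl d0 hc]]]].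
case/andP=> /eqP ne; rewrite px py => /(closeP am cm)[e h _|e|e e'].
- by rewrite /key px py e /= -addnA leq_add2l.
- by rewrite e in b0.
- case: ha => [a0|]; last by rewrite -e ltnn.
  case: hc => [c0|]; last by rewrite -e' ltnn.
  by case: ne; rewrite px py; move: e; rewrite a0 c0 in e' *; rewrite -e' => -[->].
Qed.

(** At most the next-to-last vertex of each path counts, together with the last vertex of the first
    path. *)
Lemma deg_w (B : {set T}) x : B \subset R -> pos x = (m, 1) -> deg_in near B x <= m.+1.
Proof.
move=> /subsetP BR px; pose s := (0, len 0 - 2) :: [seq (i, len i - 3) | i <- iota 0 m].
have ss : size s = m.+1 by rewrite /= size_map size_iota.
rewrite -ss; apply: (@deg_in_le _ _ _ pos) => [y z _ _|y /BR/Rpos[c [d [py [cm dl d0 hc]]]]].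
  exact: pos_inj.
case/andP=> _; rewrite px py => /(close_wP cm) h.
have [e|ne] := eqVneq (len c) d.+2.
  case: hc => [c0|]; last by rewrite e ltnn.
  by rewrite c0 in e *; rewrite inE e !subSS subn0 eqxx.
have -> : d = len c - 3 by clear -dl h ne; lia.
by rewrite inE map_f ?orbT // mem_iota.
Qed.

(** Besides two predecessors, only the last vertex of the first path can be seen, through w. *)
Lemma deg_end (B : {set T}) x i : B \subset R -> i < m ->
  pos x = (i, len i - 2) -> deg_in near B x <= 3.
Proof.
move=> /subsetP BR im px.
apply: (@deg_in_le _ _ _ pos _ _ [:: (i, len i - 3); (i, len i - 4); (0, len 0 - 2)]).
  by move=> y z _ _; apply: pos_inj.
move=> y /BR/Rpos[c [d [py [cm dl d0 hc]]]]; case/andP=> /eqP.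
rewrite px py => ne /(closeP im cm)[e h _|_ e|_ e].
- have /orP[] : (d == len i - 3) || (d == len i - 4).
    have : d != len i - 2 by apply/eqP=> e'; apply: ne; rewrite e' e.
    by rewrite -e in dl; clear -dl h; lia.
  + by move/eqP->; rewrite -e !inE eqxx.
  + by move/eqP->; rewrite -e !inE eqxx orbT.
- by rewrite e in d0.
- case: hc => [c0|]; last by rewrite -e ltnn.
  by rewrite c0 in e *; rewrite -e !inE !subSS subn0 eqxx !orbT.
Qed.

End InsideSpider.

(** * Assembling the blocks *)

Section Coloring.
Variables (k : nat) (L : T -> seq nat).
Hypotheses (mk : m + 3 <= k) (kL : k_assignment L k).

Let w : T := inl false.

(* Every internal vertex outside [base] has at most m + 2 neighbors outside [base], hence any such
   vertices may complete [base] to a block. *)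
Lemma first_block : k < #|T| -> exists s : seq T,
  [/\ uniq s, size s = k, w \notin s, {subset base <= s}
    & fits (deg_in near (setT :\: [set x in s])) s].
Proof.
(* The vertex w is kept for the next block, which it heads. *)
move=> kn; pose C := ~: [set x in w :: base].
pose ext := take (k - (m + 3)) (enum C).
have sext : size ext = k - (m + 3).
  have sb : #|[set x in w :: base]| <= (m + 3).+1.
    by rewrite -size_base cardsE; apply: (card_size (w :: base)).
  rewrite size_takel // -cardE leq_subLR /C.
  by move: kn; rewrite -(cardsC [set x in w :: base]); lia.
have extC x : x \in ext -> x \in C by move=> /mem_take; rewrite mem_enum.
exists (ext ++ base); split.
- rewrite cat_uniq take_uniq ?enum_uniq // uniq_base andbT andTb.
  apply/hasPn=> x xb; apply/negP=> /extC.
  by rewrite in_setC in_set in_cons xb orbT.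
- by rewrite size_cat sext size_base; lia.
- rewrite mem_cat negb_or; apply/andP; split.
    by apply/negP=> /extC; rewrite in_setC in_set mem_head.
  by rewrite mem_base /=; lia.
- by move=> x xb; rewrite mem_cat xb orbT.
have HB : {in setT :\: [set x in ext ++ base], forall y, y \notin base}.
  by move=> y; rewrite in_setD in_set mem_cat negb_or => /andP[/andP[]].
apply: fits_cat; last exact: fits_base.
move=> x /extC; rewrite in_setC in_set in_cons negb_or => /andP[xw xb].
have := xb; rewrite mem_base size_base; case E: (pos x) / (posP x) => [||a b am bl] /=.
- by lia.
- by have := pos_inj (_ : pos x = pos w); move/(_ E)/eqP; rewrite (negPf xw).
- move=> H; apply: leq_trans (_ : m + 2 <= _); last by lia.
  by apply: (deg_interior HB E am bl); lia.
Qed.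

Lemma theta_colorable : colorable near L setT (ceil_div #|T| k).
Proof.
have k0 : 0 < k by lia.
rewrite -cardsT; have [|kn] := leqP #|[set: T]| k.
  exact: (colorable_le near_sym near_irr kL).
rewrite cardsT in kn.
have [s1 [us1 ss1 ws1 bs1 fs1]] := first_block kn.
apply: (colorable_full_block near_sym near_irr kL k0 us1 ss1 _ fs1).
  by move=> x _; rewrite inE.
set A := _ :\: _; have [|kA] := leqP #|A| k.
  exact: (colorable_le near_sym near_irr kL).
have Ab : {in A, forall y, y \notin base}.
  by move=> y; rewrite !inE andbT; apply: contra => /bs1.
have wA : w \in A by rewrite !inE ws1.
clearbody A.
(* The end of the first path stays in R, so that size E <= m - 1 and at least 3 vertices are taken from R. *)
pose E := [seq x <- [seq vertex i (len i - 2) | i <- iota 1 (m - 1)] | x \in A].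
have pE i : i \in iota 1 (m - 1) -> pos (vertex i (len i - 2)) = (i, len i - 2).
  rewrite mem_iota => im; apply: pos_vertex; first lia.
  by have li := @lenS i; lia.
have uE : uniq E.
  rewrite filter_uniq // map_inj_in_uniq ?iota_uniq // => i j im jm.
  by move/(congr1 pos); rewrite !pE // => -[].
have EA x : x \in E -> x \in A by rewrite mem_filter => /andP[].
have posE x : x \in E -> exists2 i, 0 < i < m & pos x = (i, len i - 2).
  rewrite mem_filter => /andP[_ /mapP[i im ->]]; exists i; last exact: pE.
  by move: im; rewrite mem_iota; lia.
have wE : w \notin E by apply/negP=> /posE[i im [e]]; lia.
have sE : size E <= m - 1.
  by rewrite size_filter (leq_trans (count_size _ _)) // size_map size_iota.
have endE c y : c \in iota 1 (m - 1) -> pos y = (c, len c - 2) -> y \in A -> y \in E.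
  move=> ci py yA; rewrite mem_filter yA; apply/mapP; exists c => //.
  by apply: pos_inj; rewrite py pE.
clearbody E; pose R := A :\: [set x in w :: E].
have RA : {subset R <= A} by move=> x; rewrite inE => /andP[].
have Rb : {in R, forall y, y \notin base} by move=> y /RA /Ab.
have Rpos y : y \in R -> exists c d, pos y = (c, d) /\
    [/\ c < m, d.+1 < len c, 0 < d & c = 0 \/ d.+2 < len c].
  move=> yR; case: (outside_base Rb yR) => [yw|[c [d [py /and4P[cm dl d0 _]]]]].
    move: yR; have -> : y = w by apply: pos_inj.
    by rewrite !inE eqxx.
  exists c, d; split=> //; split=> //; case: (posnP c) => c0; [by left|right].
  rewrite ltn_neqAle dl andbT; apply/negP=> /eqP de; move: yR.
  rewrite in_setD in_set in_cons negb_or => /andP[/andP[_ /negP yE] yA]; case: yE.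
  apply: (endE c) => //; last by rewrite py -de !subSS subn0.
  by rewrite mem_iota c0 subnKC // (leq_ltn_trans _ cm).
have R_inj : {in R &, injective key} by move=> x y _ _; apply: key_inj.
have R_key := key_near Rpos.
have Ek : size E <= k - 1 by apply: leq_trans sE _; clear -mk; lia.
(* (m + 3) - 1 - (m - 1) = 3, as both [top_block] and the bound of [deg_end] require. *)
have r3 : 3 <= k - 1 - size E by clear -mk sE m3; lia.
have [//||t [ut st tR ft]] := top_block R_inj R_key (r := k - 1 - size E).
- have cE : #|[set x in w :: E]| <= (size E).+1 by rewrite cardsE; apply: card_size.
  have := subset_leq_card (subsetIr A [set x in w :: E]).
  by have := cardsID [set x in w :: E] A; rewrite -/R; lia.
have ARt : A :\: [set x in w :: E ++ t] = R :\: [set x in t].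
  by apply/setP=> x; rewrite !(inE, mem_cat) !negb_or; case: (x == w) (x \in E) (x \in t) => [] [] [].
apply: (colorable_full_block near_sym near_irr kL k0 (s := w :: E ++ t)).
- rewrite /= mem_cat negb_or wE cat_uniq uE ut andbT /=; apply/andP; split.
    by apply/negP=> /tR; rewrite !inE eqxx.
  by apply/hasPn=> x /tR; rewrite !inE negb_or => /andP[/andP[]].
- by rewrite /= size_cat st subnKC // subn1 prednK.
- move=> x; rewrite inE mem_cat => /or3P[/eqP->//|/EA//|/tR/RA//].
(* The head w has k - 1 >= m + 2 successors against m + 1 neighbors; each vertex of [E] is followed
   by all of [t], at least 3 vertices. *)
- rewrite ARt /= size_cat st subnKC //; apply/andP; split.
    apply: leq_trans (deg_w (x := w) Rpos (subsetDl R _) erefl) _.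
    by clear -mk; lia.
  apply: fits_cat => // x /posE[i /andP[i0 im] px]; rewrite st.
  apply: leq_trans r3; apply: (deg_end Rpos _ im px); exact: subsetDl.
- rewrite ARt; apply: (colorable_keyed near_sym near_irr kL (key := key)); first by lia.
    by move=> x y /setDP[xR _] /setDP[yR _]; apply: R_inj.
  by move=> x y /setDP[xR _] /setDP[yR _]; apply: R_key.
Qed.

End Coloring.
End ThetaSquare.

Theorem theorem3p2 (l : seq nat) :
  (3 <= size l)%N -> sorted leq l ->
  (2 <= nth 0 l 0)%N -> (4 <= nth 0 l 1)%N ->
  forall k : nat, (size l + 3 <= k)%N ->
    equitably_choosable (sq_graph (@theta_adj l)) k.
Proof.
move=> m3 sl l0 l1 k mk L kL.
have lenS i : 0 < i -> i < size l -> 4 <= nth 0 l i.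
  move=> i0 im; apply: leq_trans l1 _.
  by apply: (sorted_leq_nth leq_trans leqnn 0 sl) => //; rewrite inE; apply: leq_trans m3.
have [f [fL fG fq]] := theta_colorable m3 l0 lenS mk kL.
exists f; split=> [v|x y /(sq_theta_near m3 l0 lenS) xy|c].
- by apply: fL; rewrite inE.
- by apply: fG; rewrite ?inE.
- by apply: leq_trans (fq c); apply: eq_leq; apply: eq_card => v; rewrite !inE.
Qed.
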